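(* For $\alpha\in[0,1]$ let $\mathbb{N}_\alpha$ denote the space $\mathbb{N}_{1/n^\alpha}$. Then for all $\alpha,\beta\in[0,1]$ with $\alpha<\beta$, there is a continuous bijection $\mathbb{N}_\beta\rightarrow\mathbb{N}_\alpha$, but the only continuous functions $\mathbb{N}_\alpha\rightarrow\mathbb{N}_\beta$ are the constant ones.
   Context: $\mathbb{N}=\{1,2,3,\dots\}$. For a series $\sum_{n=1}^\infty a_n$ of strictly positive real numbers and $A\subseteq\mathbb{N}$, write $\sum_A a_n=\sum_{n\in A}a_n\in[0,\infty]$. $\mathbb{N}_{a_n}$ denotes the set $\mathbb{N}$ with the topology whose closed sets are exactly $\mathbb{N}$ itself and all $A\subseteq\mathbb{N}$ with $\sum_A a_n<\infty$. Thus $\mathbb{N}_{1/n^\alpha}$ is the space obtained from $a_n=1/n^\alpha$. *)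

(* Defs.v *)
From HB Require Import structures.
From mathcomp Require Import all_boot all_order all_algebra.
From mathcomp Require Import all_classical all_reals all_analysis.
Set Implicit Arguments.
Unset Strict Implicit.
Unset Printing Implicit Defensive.
Import Order.TTheory GRing.Theory Num.Theory.
Import numFieldNormedType.Exports.
Local Open Scope classical_set_scope.
Local Open Scope ring_scope.

Definition posnat : Type := {n : nat | (0 < n)%N}.
HB.instance Definition _ := Choice.on posnat.

(* The parameter [a] does not occur in the body: it serves to attach to each
   series its own topology on the positive integers. *)
Definition series_space (R : realType) (a : posnat -> {posnum R}) : Type :=
  posnat.

Section SeriesSpace.
Variables (R : realType) (a : posnat -> {posnum R}).

Definition set_sum (A : set posnat) : \bar R :=
  (\esum_(n in A) ((a n)%:num)%:E)%E.

Definition series_closed (A : set posnat) : Prop :=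
  A = setT \/ (set_sum A < +oo)%E.

HB.instance Definition _ := Choice.on (series_space a).

Definition series_open (U : set (series_space a)) : Prop := series_closed (~` U).

Lemma set_sum_subset (A B : set posnat) :
  A `<=` B -> (set_sum A <= set_sum B)%E.
Proof.
move=> AB; apply: le_ereal_sup => _ [F [finF FA] <-]; exists F => //.
by split=> //; apply: subset_trans AB.
Qed.

Lemma set_sumU (A B : set posnat) :
  (set_sum (A `|` B) <= set_sum A + set_sum B)%E.
Proof.
rewrite /set_sum (esumID A) => [|n _]; last by rewrite lee_fin.
apply: leeD; apply: set_sum_subset => n [] //.
by case.
Qed.

Lemma series_openT : series_open setT.
Proof. by right; rewrite setCT /set_sum esum_set0. Qed.

Lemma series_openI : setI_closed series_open.
Proof.
move=> U V; rewrite /series_open /series_closed setCI.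
case=> [->|oU]; first by left; rewrite setTU.
case=> [->|oV]; first by left; rewrite setUT.
by right; apply: le_lt_trans (set_sumU _ _) _; exact: lte_add_pinfty.
Qed.

Lemma series_open_bigU (I : Type) (f : I -> set (series_space a)) :
  (forall i, series_open (f i)) -> series_open (\bigcup_i f i).
Proof.
move=> fo; rewrite /series_open setC_bigcup.
have [[i fi]|nf] := pselect (exists i, (set_sum (~` f i) < +oo)%E).
  by right; apply: le_lt_trans fi; apply: set_sum_subset => x; apply.
left; apply/seteqP; split=> // x _ i _.
by case: (fo i) => [->//|fi]; case: nf; exists i.
Qed.

HB.instance Definition _ :=
  isOpenTopological.Build (series_space a)
    series_openT series_openI series_open_bigU.

Lemma series_space_closedE (A : set (series_space a)) :
  closed A <-> A = setT \/ (set_sum A < +oo)%E.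
Proof. by rewrite -openC /open /= /series_open setCK. Qed.

End SeriesSpace.

Lemma inv_power_gt0 (R : realType) (alpha : R) (n : posnat) :
  0 < ((val n)%:R `^ alpha)^-1.
Proof. by rewrite invr_gt0 powR_gt0// ltr0n (valP n). Qed.

Definition inv_power (R : realType) (alpha : R) (n : posnat) : {posnum R} :=
  PosNum (inv_power_gt0 alpha n).

Definition power_space (R : realType) (alpha : R) : topologicalType :=
  series_space (inv_power alpha).

(* Main.v *)
(** The identity is a continuous bijection since [n^-beta <= n^-alpha].

Conversely let [g : N_alpha -> N_beta] be continuous and not constant, so that
its fibres have finite mass [w m = sum of n^-alpha over g n = m]. One may assume
[beta < 1]. Call [m] heavy if [w m >= K m^-beta]. Only [m] up to order
[x^(alpha/beta)] can be light and hit by some [n <= x], so the light fibres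
account for mass of order at most [x^((alpha/beta)(1-beta))] below [x], which is
negligible against the total mass, at least [x^(1-alpha)]. Hence for every [K]
the heavy fibres have arbitrarily large mass, which yields finite sets [Q_k]
whose beta-mass is at most [2^-k] while their preimages have alpha-mass at least
[k + 1]. The union [B] of the [Q_k] is closed and its preimage has infinite
mass; if that preimage is everything, remove one value of [g] from [B]. *)

Require Import Defs.
From mathcomp Require Import all_boot all_order all_algebra.
From mathcomp Require Import all_classical all_reals all_analysis.
From mathcomp Require Import ring lra.
Import Order.TTheory GRing.Theory Num.Theory.
Import numFieldNormedType.Exports.
Local Open Scope classical_set_scope.
Local Open Scope ring_scope.

(* The positive integer [n + 1] is represented by [n : nat] throughout. *)
Definition bounded_sums {R : realType} (u : nat -> R) (A : set nat) :=
  exists C, forall x, \sum_(i < x | (i : nat) \in A) u i <= C.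

Definition inv_pow {R : realType} (d : R) (n : nat) : R := (n.+1%:R `^ d)^-1.

Definition pos_succ (n : nat) : posnat := exist _ n.+1 (ltn0Sn n).

(** * Bounds for the terms and partial sums of the series of [n ^ -d] *)

Lemma inv_pow_gt0 {R : realType} (d : R) n : 0 < inv_pow d n.
Proof. by rewrite invr_gt0 powR_gt0// ltr0n. Qed.

Lemma inv_pow_ge0 {R : realType} (d : R) n : 0 <= inv_pow d n.
Proof. exact: ltW (inv_pow_gt0 d n). Qed.

Lemma le_inv_pow {R : realType} (d e : R) n : d <= e -> inv_pow e n <= inv_pow d n.
Proof.
move=> de; rewrite lef_pV2 ?posrE ?powR_gt0 ?ltr0n//.
by rewrite ler_powR// ler1n.
Qed.

Lemma inv_pow_antitone {R : realType} (d : R) m n :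
  0 <= d -> (m <= n)%N -> inv_pow d n <= inv_pow d m.
Proof.
move=> d0 mn; rewrite lef_pV2 ?posrE ?powR_gt0 ?ltr0n//.
by apply: ge0_ler_powR; rewrite ?nnegrE ?ler0n// ler_nat ltnS.
Qed.

Lemma exists_powR_ge {R : realType} (r D : R) : 0 < r ->
  exists2 x : nat, (0 < x)%N & D <= x%:R `^ r.
Proof.
move=> r0; pose e := Num.max D 1.
have e1 : 1 <= e by rewrite le_max lexx orbT.
have e0 : 0 <= e by exact: le_trans e1.
pose x := (Num.truncn (e `^ r^-1)).+1; exists x => //.
have lex : e `^ r^-1 <= x%:R by rewrite ltW// truncnS_gt.
apply: (@le_trans _ _ e); first by rewrite le_max lexx.
have -> : e = (e `^ r^-1) `^ r by rewrite -powRrM mulVf ?gt_eqF// powRr1.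
by apply: ge0_ler_powR; rewrite ?nnegrE ?powR_ge0 ?ler0n// ltW.
Qed.

Lemma inv_pow_small {R : realType} (d e : R) : 0 < d -> 0 < e ->
  exists M, forall m, (M <= m)%N -> inv_pow d m <= e.
Proof.
move=> d0 e0; have [M M0 eM] := exists_powR_ge d e^-1 d0.
exists M => m Mm; rewrite invf_ple ?posrE ?powR_gt0 ?ltr0n//.
apply: le_trans eM _.
by apply: ge0_ler_powR; rewrite ?nnegrE ?ler0n ?ler_nat ?(ltW d0)// leqW.
Qed.

(* Weighted AM-GM applied to [n] and [n+1], with weights [1 - d] and [d]. *)
Lemma inv_pow_telescope {R : realType} (d : R) n : 0 < d < 1 ->
  (1 - d) * inv_pow d n <= n.+1%:R `^ (1 - d) - n%:R `^ (1 - d).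
Proof.
move=> /andP[d0 d1].
have n0 : 0 < n.+1%:R `^ d by rewrite powR_gt0// ltr0n.
have s0 : 0 < 1 - d by lra.
have := @conjugate_powR R (n%:R `^ (1 - d)) (n.+1%:R `^ d) (1 - d)^-1 d^-1
  (powR_ge0 _ _) (powR_ge0 _ _).
rewrite !invr_gt0 !invrK => /(_ s0 d0 (subrK _ _)).
rewrite -!powRrM !mulfV ?gt_eqF// !powRr1 ?ler0n// => amgm.
rewrite -(ler_pM2r n0) -mulrA mulVf ?gt_eqF// mulr1 mulrBl -powRD; last first.
  by rewrite pnatr_eq0 implybT.
rewrite subrK powRr1 ?ler0n// -natr1 in amgm *.
lra.
Qed.

Lemma sum_inv_pow_le {R : realType} (d : R) y : 0 < d < 1 ->
  (1 - d) * \sum_(m < y) inv_pow d m <= y%:R `^ (1 - d).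
Proof.
move=> d01; elim: y => [|y IH].
  by rewrite big_ord0 mulr0 powR_ge0.
rewrite big_ord_recr/= mulrDr; have := inv_pow_telescope d y d01.
move: IH; lra.
Qed.

(** Each of the [x] terms is at least [x ^ -d]. *)
Lemma sum_inv_pow_ge {R : realType} (d : R) x : 0 <= d -> (0 < x)%N ->
  x%:R `^ (1 - d) <= \sum_(n < x) inv_pow d n.
Proof.
move=> d0 x0; have xn0 : x%:R != 0 :> R by rewrite pnatr_eq0 -lt0n.
rewrite powRB ?xn0 ?implybT// powRr1 ?ler0n//.
rewrite mulr_natl -[X in _ *+ X]card_ord -sumr_const; apply: ler_sum => i _.
case: x i x0 {xn0} => [[]//|x] i _.
by apply: (@inv_pow_antitone R d i x d0); rewrite -ltnS.
Qed.

(** * Finite sums over fibres *)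

Lemma sum_fibres {R : realType} (x : nat) (G : nat -> nat) (t : seq nat)
    (F : nat -> R) : uniq t ->
  \sum_(n < x | G n \in t) F n = \sum_(m <- t) \sum_(n < x | G n == m) F n.
Proof.
elim: t => [|m t IH] /=; first by rewrite big_nil big_pred0.
move=> /andP[mt ut]; rewrite big_cons -IH// (bigID (fun n : 'I_x => G n == m))/=.
congr (_ + _); apply: eq_bigl => n; rewrite inE.
  by case: eqP; rewrite ?orbT ?andbF.
by case: eqP => [->|_]; rewrite ?(negbTE mt) ?andbT ?andbF.
Qed.

Lemma sum_ord_mem_le {R : realType} (x : nat) (t : seq nat) (F : nat -> R) :
  (forall n, 0 <= F n) -> uniq t ->
  \sum_(n < x | (n : nat) \in t) F n <= \sum_(m <- t) F m.
Proof.
move=> F0 ut; rewrite (sum_fibres x id)//=; apply: ler_sum => m _.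
by rewrite (big_ord1_eq _ F); case: ifP.
Qed.

(** * Sets with bounded partial sums *)

Lemma bounded_sums_sub {R : realType} (u : nat -> R) (A B : set nat) :
  (forall n, 0 <= u n) -> A `<=` B -> bounded_sums u B -> bounded_sums u A.
Proof.
move=> u0 AB [C HC]; exists C => x; apply: le_trans (HC x).
rewrite big_mkcond [leRHS]big_mkcond; apply: ler_sum => i _.
case: ifP => [|_]; last by case: ifP.
by move=> /set_mem/AB/mem_set ->.
Qed.

Lemma bounded_sumsU {R : realType} (u : nat -> R) (A B : set nat) :
  (forall n, 0 <= u n) -> bounded_sums u A -> bounded_sums u B ->
  bounded_sums u (A `|` B).
Proof.
move=> u0 [C HC] [D HD]; exists (C + D) => x; apply: le_trans (lerD (HC x) (HD x)).
rewrite big_mkcond [X in _ <= X + _]big_mkcond [X in _ <= _ + X]big_mkcond.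
rewrite -big_split/=; apply: ler_sum => i _; rewrite in_setU.
by case: (_ \in A); case: (_ \in B) => /=; have := u0 i; lra.
Qed.

Lemma bounded_sums_le {R : realType} (u v : nat -> R) (A : set nat) :
  (forall n, u n <= v n) -> bounded_sums v A -> bounded_sums u A.
Proof.
by move=> uv [C HC]; exists C => x; apply: le_trans (HC x); exact: ler_sum.
Qed.

(** The set is a finite union of fibres. This makes all targets below a fixed threshold
    negligible. *)
Lemma bounded_sums_preimage_lt {R : realType} (u : nat -> R) (G : nat -> nat) M :
  (forall n, 0 <= u n) -> (forall m, bounded_sums u (G @^-1` [set m])) ->
  bounded_sums u [set n | (G n < M)%N].
Proof.
move=> u0 fib; elim: M => [|M IH].
  by exists 0 => x; rewrite big_pred0// => i; rewrite memNset.
apply: bounded_sums_sub (bounded_sumsU _ _ _ u0 IH (fib M)) => // n /=.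
by rewrite ltnS leq_eqVlt => /orP[/eqP|]; [right|left].
Qed.

(** * Heavy and light fibres *)

(* Take a minimal sublist whose [w]-mass is at least [T]. *)
Lemma light_subseq {R : realType} (s : seq nat) (w b : nat -> R) (T K e : R) :
  0 <= T -> 0 <= K -> 0 <= e -> uniq s ->
  (forall m, m \in s -> K * b m <= w m) -> (forall m, m \in s -> b m <= e) ->
  T <= \sum_(m <- s) w m ->
  exists t, [/\ uniq t, T <= \sum_(m <- t) w m &
                K * \sum_(m <- t) b m <= T + K * e].
Proof.
move=> T0 K0 e0; elim: s => [|m s IH] /=.
  move=> _ _ _ HT; exists [::]; split => //.
  by rewrite big_nil mulr0 addr_ge0 ?mulr_ge0.
move=> /andP[ms us] Hw Hb HT.
have Hw' m' : m' \in s -> K * b m' <= w m' by move=> ?; apply: Hw; rewrite inE orbC; apply/orP; left.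
have [Ts|sT] := leP T (\sum_(m <- s) w m).
  by apply: IH => // m' m's; apply: Hb; rewrite inE m's orbT.
exists (m :: s); split => //; first by rewrite /= ms.
rewrite big_cons mulrDr addrC lerD//.
  rewrite mulr_sumr; apply: le_trans (ltW sT).
  by rewrite !big_seq; apply: ler_sum.
by apply: ler_wpM2l => //; apply: Hb; rewrite mem_head.
Qed.

(** Since [n < x], the hypothesis gives [x ^ -a <= K * (m + 1) ^ -b], which is solved for
    [m + 1]. *)
Lemma light_target_bound {R : realType} (a b K : R) x m n :
  0 <= a -> 0 < b -> 0 < K -> (n < x)%N -> inv_pow a n <= K * inv_pow b m ->
  m.+1%:R <= (K * x%:R `^ a) `^ b^-1.
Proof.
move=> a0 b0 K0 nx H.
have x0 : (0 < x)%N by exact: leq_trans nx.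
have xa0 : 0 < x%:R `^ a by rewrite powR_gt0// ltr0n.
have mb0 : 0 < m.+1%:R `^ b by rewrite powR_gt0// ltr0n.
have : (x%:R `^ a)^-1 <= K * inv_pow b m.
  apply: le_trans H; case: x nx x0 {xa0} => // x nx _.
  exact: (@inv_pow_antitone R a n x a0).
rewrite /inv_pow ler_pdivlMr// mulrC ler_pdivrMr// => H'.
have -> : m.+1%:R = (m.+1%:R `^ b) `^ b^-1 :> R.
  by rewrite -powRrM mulfV ?gt_eqF// powRr1.
apply: ge0_ler_powR; rewrite ?nnegrE ?powR_ge0 ?invr_ge0 ?(ltW b0)//.
by rewrite mulr_ge0 ?powR_ge0 ?(ltW K0).
Qed.

(** Below a large [x] the total mass is at least [x ^ (1 - a)]. Targets below [M] take at most [C]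
    of it and light fibres at most [K' * x ^ q] with [q < 1 - a], so the heavy fibres carry at least
    [T]. *)
Lemma heavy_preimage {R : realType} (a b : R) (G : nat -> nat) (T e : R) :
  0 <= a -> a < b -> b < 1 ->
  (forall m, bounded_sums (inv_pow a) (G @^-1` [set m])) ->
  0 < T -> 0 < e ->
  exists t x, [/\ uniq t, \sum_(m <- t) inv_pow b m <= e &
                 T <= \sum_(n < x | G n \in t) inv_pow a n].
Proof.
move=> a0 ab b1 fib T0 e0.
have b0 : 0 < b by exact: le_lt_trans ab.
(* From [M] on a single target weighs at most [e / 2], the overshoot allowed when the heavy targets
   are thinned out at the end. *)
have [M HM] := inv_pow_small b (e / 2) b0 (divr_gt0 e0 (ltr0Sn _ _)).
have [C HC] := bounded_sums_preimage_lt (inv_pow a) G M (inv_pow_ge0 a) fib.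
have C0 : 0 <= C by apply: le_trans (HC 0%N); rewrite big_ord0.
(* Chosen so that [T = K * (e / 2)]; the final bound [T + K * (e / 2)] is then [K * e]. *)
pose K := 2 * T / e.
have K0 : 0 < K by rewrite divr_gt0// mulr_gt0.
pose s := 1 - b.
have s0 : 0 < s by rewrite subr_gt0.
(* The light targets lie below a multiple of [x ^ (a / b)], and the [b]-mass below [y] is of order
   at most [y ^ s]; this gives the exponent [q]. *)
pose q := a * b^-1 * s.
pose K' := K * (K `^ b^-1) `^ s / s.
have K'0 : 0 <= K' by rewrite divr_ge0 ?(ltW s0)// mulr_ge0 ?powR_ge0 ?(ltW K0).
have q0 : 0 <= q by rewrite !mulr_ge0 ?invr_ge0 ?(ltW b0) ?(ltW s0).
have r0 : 0 < 1 - a - q.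
  have -> : 1 - a - q = 1 - a * b^-1.
    by rewrite /q /s mulrBr mulr1 mulfVK ?gt_eqF//; lra.
  by rewrite subr_gt0 ltr_pdivrMr// mul1r.
have [x x0 Hx] := exists_powR_ge (1 - a - q) (K' + C + T) r0.
pose w m := \sum_(n < x | G n == m) inv_pow a n.
pose heavy m := (M <= m)%N && (K * inv_pow b m <= w m).
(* [Z] exceeds all values of [G] below [x], so [tH] contains every heavy target that occurs
   there. *)
pose Z := (\max_(n < x) G n).+1.
pose tH := [seq m <- iota 0 Z | heavy m].
(* A light target [m] hit by some [n < x] satisfies [m + 1 <= y], hence [m < Y]. *)
pose y := (K * x%:R `^ a) `^ b^-1.
pose Y := Num.truncn y.
pose tL := [seq m <- iota 0 Y | w m <= K * inv_pow b m].
have uH : uniq tH by rewrite filter_uniq ?iota_uniq.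
have uL : uniq tL by rewrite filter_uniq ?iota_uniq.
have sumL : \sum_(n < x | G n \in tL) inv_pow a n <= K' * x%:R `^ q.
  rewrite sum_fibres//.
  have : \sum_(m <- tL) w m <= K * \sum_(m < Y) inv_pow b m.
    rewrite mulr_sumr -(big_mkord xpredT (fun m => K * inv_pow b m)).
    rewrite /index_iota subn0 big_filter big_mkcond/=; apply: ler_sum => m _.
    by case: ifP => // _; rewrite mulr_ge0 ?inv_pow_ge0 ?(ltW K0).
  move/le_trans; apply.
  have Ys : Y%:R `^ s <= y `^ s.
    apply: ge0_ler_powR; rewrite ?nnegrE ?ler0n ?powR_ge0 ?(ltW s0)//.
    by rewrite truncn_le powR_ge0.
  have ys : y `^ s = (K `^ b^-1) `^ s * x%:R `^ q.
    by rewrite /y powRM ?powR_ge0 ?(ltW K0)// powRM ?powR_ge0// /q !powRrM.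
  have := sum_inv_pow_le b Y; rewrite b0 b1 -/s => /(_ isT) sumY.
  have {sumY} : s * \sum_(m < Y) inv_pow b m <= (K `^ b^-1) `^ s * x%:R `^ q.
    by rewrite -ys; exact: le_trans Ys.
  rewrite mulrC -ler_pdivlMr// => sumY.
  apply: le_trans (ler_wpM2l (ltW K0) sumY) _.
  by rewrite /K' !mulrA [X in _ <= X]mulrAC.
(* Each [n < x] is counted at least once on the right: its target is below [M], light or heavy. *)
have sumT : \sum_(n < x) inv_pow a n <= C + K' * x%:R `^ q +
    \sum_(n < x | G n \in tH) inv_pow a n.
  apply: le_trans (lerD (lerD (HC x) sumL) (lexx _)).
  rewrite big_mkcond [X in _ <= X + _ + _]big_mkcond.
  rewrite [X in _ <= _ + X + _]big_mkcond [X in _ <= _ + _ + X]big_mkcond.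
  rewrite -!big_split/=; apply: ler_sum => n _.
  have ge0 := inv_pow_ge0 a n.
  have ite0 (c : bool) : 0 <= if c then inv_pow a n else 0 by case: c.
  have [GM|MG] := ltnP (G n) M.
    by rewrite mem_set//= -addrA lerDl addr_ge0.
  have [wK|Kw] := leP (w (G n)) (K * inv_pow b (G n)).
    rewrite [in X in _ <= _ + X + _]mem_filter wK mem_iota/= add0n.
    have aK : inv_pow a n <= K * inv_pow b (G n).
      apply: le_trans wK; rewrite /w (bigD1 n)//= lerDl.
      by apply: sumr_ge0 => i _; exact: inv_pow_ge0.
    rewrite truncn_gt_nat (light_target_bound _ _ _ _ _ _ a0 b0 K0 (ltn_ord n) aK).
    by rewrite -addrA addrCA lerDl addr_ge0.
  rewrite [in X in _ <= _ + _ + X]mem_filter /heavy MG (ltW Kw) mem_iota/= add0n.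
  by rewrite ltnS (leq_bigmax n) lerDr addr_ge0.
have xq1 : 1 <= x%:R `^ q.
  by rewrite -[leLHS](powRr0 x%:R) ler_powR// ler1n.
have xn0 : x%:R != 0 :> R by rewrite pnatr_eq0 -lt0n.
have xpow : x%:R `^ (1 - a) = x%:R `^ (1 - a - q) * x%:R `^ q.
  by rewrite -powRD ?subrK// xn0 implybT.
(* After the light part, [(C + T) * x ^ q] is left, and this is at least [C + T] because
   [1 <= x ^ q]. *)
have massH : T <= \sum_(n < x | G n \in tH) inv_pow a n.
  have := sum_inv_pow_ge a x a0 x0; rewrite xpow => lo.
  have : (K' + C + T) * x%:R `^ q <= x%:R `^ (1 - a - q) * x%:R `^ q.
    by rewrite ler_wpM2r ?powR_ge0.
  have : C + T <= (C + T) * x%:R `^ q by rewrite ler_peMr// addr_ge0 ?(ltW T0).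
  move: lo sumT; lra.
have e20 : 0 <= e / 2 by rewrite divr_ge0 ?(ltW e0).
have [t [ut Tt Kt]] : exists t, [/\ uniq t, T <= \sum_(m <- t) w m &
    K * \sum_(m <- t) inv_pow b m <= T + K * (e / 2)].
  apply: (light_subseq tH) => //; [exact: ltW|exact: ltW| | |].
  - by move=> m; rewrite mem_filter => /andP[/andP[]].
  - by move=> m; rewrite mem_filter => /andP[/andP[Mm _] _]; exact: HM.
  - by rewrite -sum_fibres.
exists t, x; split => //; last by rewrite sum_fibres.
rewrite -(ler_pM2l K0); apply: le_trans Kt _.
have -> : T = K * (e / 2) by rewrite /K; field; rewrite gt_eqF.
lra.
Qed.

(** * A set of finite mass whose preimage has infinite mass *)

(** A union bound, together with the geometric series of sum [2]. *)
Lemma bounded_sums_bigcup {R : realType} (u : nat -> R) (t : nat -> seq nat) :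
  (forall n, 0 <= u n) -> (forall k, uniq (t k)) ->
  (forall k, \sum_(m <- t k) u m <= (2 ^+ k)^-1) ->
  bounded_sums u [set m | exists k, m \in t k].
Proof.
move=> u0 ut Ht; exists 2 => x.
(* Each element of the union is charged to one list containing it; the default [0] is for the other
   numbers. Below [x], the first [Z] lists then suffice. *)
have [kf Hkf] : {kf : nat -> nat & forall m, (exists k, m \in t k) -> m \in t (kf m)}.
  apply: (@choice _ _ (fun m k => (exists k, m \in t k) -> m \in t k)) => m.
  have [[k mk]|nk] := pselect (exists k, m \in t k); first by exists k.
  by exists 0%N.
pose Z := (\max_(m < x) kf m).+1.
apply: (@le_trans _ _ (\sum_(m < x) \sum_(k < Z | (m : nat) \in t k) u m)).
  rewrite big_mkcond; apply: ler_sum => m _; case: ifP => [/set_mem mB|_].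
    have kZ : (kf m < Z)%N by rewrite ltnS (leq_bigmax m).
    rewrite (bigD1 (Ordinal kZ))/=; last exact: Hkf.
    by rewrite lerDl sumr_ge0.
  exact: sumr_ge0.
rewrite (exchange_big_dep xpredT)//=.
apply: (@le_trans _ _ (\sum_(k < Z) (2 ^+ k)^-1)).
  by apply: ler_sum => k _; apply: le_trans (sum_ord_mem_le _ _ _ u0 (ut k)) (Ht k).
have -> : \sum_(k < Z) (2 ^+ k)^-1 = 2 - 2 * (2 ^+ Z)^-1 :> R.
  elim: Z => [|Z IH]; first by rewrite big_ord0 expr0 invr1; lra.
  by rewrite big_ord_recr/= IH exprS invfM; lra.
by rewrite lerBlDr lerDl mulr_ge0 ?invr_ge0 ?exprn_ge0.
Qed.

Lemma unbounded_preimage {R : realType} (a b : R) (G : nat -> nat) :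
  0 <= a -> a < b -> b < 1 ->
  (forall m, bounded_sums (inv_pow a) (G @^-1` [set m])) ->
  exists B, bounded_sums (inv_pow b) B /\ ~ bounded_sums (inv_pow a) (G @^-1` B).
Proof.
move=> a0 ab b1 fib.
have [t Ht] : {t : nat -> seq nat & forall k, exists x,
    [/\ uniq (t k), \sum_(m <- t k) inv_pow b m <= (2 ^+ k)^-1 &
        k.+1%:R <= \sum_(n < x | G n \in t k) inv_pow a n]}.
  apply: (@choice _ _ (fun k s => exists x,
    [/\ uniq s, \sum_(m <- s) inv_pow b m <= (2 ^+ k)^-1 &
        k.+1%:R <= \sum_(n < x | G n \in s) inv_pow a n])) => k.
  by apply: heavy_preimage => //; rewrite invr_gt0 exprn_gt0.
exists [set m | exists k, m \in t k]; split.
  apply: bounded_sums_bigcup => [n|k|k]; first exact: inv_pow_ge0.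
    by have [x []] := Ht k.
  by have [x []] := Ht k.
(* A bound [C] is refuted by the list of index [k = truncn C], since [C < k + 1]. *)
move=> [C HC]; have [x [_ _]] := Ht (Num.truncn C); apply/negP; rewrite -ltNge.
apply: le_lt_trans (truncnS_gt C); apply: le_trans (HC x).
rewrite big_mkcond [leRHS]big_mkcond; apply: ler_sum => n _.
case: ifP => [nt|_]; last by case: ifP => // _; exact: inv_pow_ge0.
by rewrite mem_set//=; exists (Num.truncn C).
Qed.

Lemma closed_preimages_constant {R : realType} (a b : R) (G : nat -> nat) :
  0 <= a -> a < b -> b <= 1 ->
  (forall B, bounded_sums (inv_pow b) B ->
    G @^-1` B = setT \/ bounded_sums (inv_pow a) (G @^-1` B)) ->
  forall i j, G i = G j.
Proof.
(* The midpoint [c] replaces [b] to make the exponent strictly less than [1]; sets of finite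
   [c]-mass also have finite [b]-mass. *)
move=> a0 ab b1 Gc; pose c := (a + b) / 2.
have ac : a < c by rewrite /c; lra.
have cb : c <= b by rewrite /c; lra.
have c1 : c < 1 by rewrite /c; lra.
have {}Gc B : bounded_sums (inv_pow c) B ->
    G @^-1` B = setT \/ bounded_sums (inv_pow a) (G @^-1` B).
  by move=> sB; apply/Gc/bounded_sums_le/sB => n; exact: le_inv_pow.
move=> i j; apply: contrapT => Gij.
have sum1 m : bounded_sums (inv_pow c) [set m].
  exists (inv_pow c m) => x; under eq_bigl do rewrite in_set1.
  by rewrite (big_ord1_eq _ (inv_pow c)); case: ifP => // _; exact: inv_pow_ge0.
have fib m : bounded_sums (inv_pow a) (G @^-1` [set m]).
  have [all_m|//] := Gc _ (sum1 m).
  have Gm n : G n = m by have : (G @^-1` [set m]) n by rewrite all_m.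
  by case: Gij; rewrite !Gm.
have [B [sB nB]] := unbounded_preimage a c G a0 ac c1 fib.
have sB' : bounded_sums (inv_pow c) (B `\ G i).
  by apply: bounded_sums_sub sB => [n|n []//]; exact: inv_pow_ge0.
(* With [G i] removed from [B], the preimage misses [i], so it has finite mass; restoring the fibre
   of [G i] keeps the mass finite and contradicts [nB]. *)
have [all'|s'] := Gc _ sB'.
  have : (G @^-1` (B `\ G i)) i by rewrite all'.
  by case=> _; apply.
apply: nB; apply: bounded_sums_sub (bounded_sumsU _ _ _ (inv_pow_ge0 a) s' (fib (G i))).
  exact: inv_pow_ge0.
move=> n Bn; have [|neq] := eqVneq (G n) (G i); first by right.
by left; split => //; apply/eqP.
Qed.

(** * Transfer to the topological spaces *)

(** Reindexing by [pos_succ] turns the sum into a series of nonnegative terms, which is finite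
    exactly when its partial sums are bounded. *)
Lemma set_sum_lt_pinfty {R : realType} (d : R) (A : set posnat) :
  (set_sum (inv_power d) A < +oo)%E <->
  bounded_sums (inv_pow d) (pos_succ @^-1` A).
Proof.
have bij : set_bij (pos_succ @^-1` A) A pos_succ.
  split=> [n//|m n _ _ [->]//|[[//|n] n0] An].
  by exists n; [rewrite /= (_ : pos_succ n = exist _ n.+1 n0)//|]; exact: val_inj.
have -> : set_sum (inv_power d) A =
    (\sum_(i <oo | i \in pos_succ @^-1` A) (inv_pow d i)%:E)%E.
  rewrite /set_sum (reindex_esum _ _ _ _ bij) nneseries_esum; last first.
    by move=> n _; rewrite lee_fin inv_pow_ge0.
  by congr esum; apply/seteqP; split => n /=; rewrite inE.
split=> [fin|[C HC]].
  exists (fine (\sum_(i <oo | i \in pos_succ @^-1` A) (inv_pow d i)%:E)%E) => x.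
  rewrite -lee_fin fineK; last first.
    rewrite ge0_fin_numE//; apply: nneseries_ge0 => n _ _.
    by rewrite lee_fin inv_pow_ge0.
  rewrite -sumEFin -(big_mkord _ (fun i => (inv_pow d i)%:E)).
  by apply: nneseries_lim_ge => n _ _; rewrite lee_fin inv_pow_ge0.
apply: (@le_lt_trans _ _ C%:E); last exact: ltry.
apply: lime_le.
  by apply: is_cvg_nneseries => n _ _; rewrite lee_fin inv_pow_ge0.
by apply: nearW => x; rewrite big_mkord sumEFin lee_fin.
Qed.

Theorem mainTheorem8 (R : realType) (alpha beta : R)
    (halpha : 0 <= alpha <= 1) (hbeta : 0 <= beta <= 1)
    (hlt : alpha < beta) :
  (exists f : power_space beta -> power_space alpha,
     continuous f /\ bijective f) /\
  (forall g : power_space alpha -> power_space beta,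
     continuous g <-> exists c : power_space beta, forall x, g x = c).
Proof.
case/andP: halpha => a0 _; case/andP: hbeta => _ b1.
split.
  exists (id : posnat -> posnat); split; last by exists id.
  apply/continuous_closedP => A /series_space_closedE cA.
  apply/series_space_closedE; case: cA => [->|sA]; [by left|right].
  apply/set_sum_lt_pinfty; move/set_sum_lt_pinfty: sA; apply: bounded_sums_le => n.
  exact/le_inv_pow/ltW.
move=> g; split=> [/continuous_closedP gc|[c gE]]; last first.
  by rewrite (_ : g = fun=> c); [exact: cst_continuous|exact/funext].
(* [G] is [g] read on shifted indices; the predecessor loses nothing because values of [g] are
   positive. *)
pose G n := (val (g (pos_succ n) : posnat)).-1.
have GE n : g (pos_succ n) = pos_succ (G n).
  by apply: val_inj; rewrite /= prednK// (valP (g (pos_succ n) : posnat)).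
have succ_surj (m : posnat) : exists n, m = pos_succ n.
  by case: m => [[//|n] n0]; exists n; exact: val_inj.
have Gconst : forall i j, G i = G j.
  apply: (closed_preimages_constant alpha beta) => // B sB.
  have pre : pos_succ @^-1` (pos_succ @` B) = B.
    by apply/seteqP; split=> [n [m Bm [<-]]//|n Bn]; exists n.
  have /gc/series_space_closedE : closed (pos_succ @` B : set (power_space beta)).
    by apply/series_space_closedE; right; apply/set_sum_lt_pinfty; rewrite pre.
  have gpre : pos_succ @^-1` (g @^-1` (pos_succ @` B)) = G @^-1` B.
    by rewrite -[in RHS]pre; apply/seteqP; split=> n; rewrite /preimage/= GE.
  by case=> [all|/set_sum_lt_pinfty]; [left; rewrite -gpre all|rewrite gpre; right].
exists (g (pos_succ 0)) => x.
by have [n ->] := succ_surj x; rewrite !GE (Gconst n 0%N).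
Qed.
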